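(* Let $(N_n)_{n\ge 0}$ be the Narayana sequence: $N_0=0$, $N_1=1$, $N_2=1$ and $N_n=N_{n-1}+N_{n-3}$ for $n\ge 3$. Then for every integer $n\ge 0$: (a) $\sum_{k=0}^{n}N_{k}=N_{n+3}-1.$ (b) $\sum_{k=0}^{n}N_{2k}=\frac{1}{3}(N_{2n+2}+N_{2n+1}+2N_{2n}-2).$ (c) $\sum_{k=0}^{n}N_{2k+1}=\frac{1}{3}(2N_{2n+2}+2N_{2n+1}+N_{2n}-1).$ *)

(* Defs.v *)
From mathcomp Require Import all_boot all_order all_algebra.

Set Implicit Arguments.
Unset Strict Implicit.
Unset Printing Implicit Defensive.

Fixpoint narayana (n : nat) : nat :=
  match n with
  | 0 => 0
  | 1 => 1
  | 2 => 1
  | (m.+2 as p).+1 => narayana p + narayana m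
  end.

Lemma narayanaSSS n : narayana n.+3 = narayana n.+2 + narayana n.
Proof. by []. Qed.

(* Main.v *)
Require Import Defs.
From mathcomp Require Import all_boot all_order all_algebra ring.

Set Implicit Arguments.
Unset Strict Implicit.
Unset Printing Implicit Defensive.

Import GRing.Theory.
Local Open Scope ring_scope.

(** Each right-hand side grows by exactly the next summand when [n] increases by one, and its
    constant is fixed at [n = 0]. In (a) this is the telescoping N_k = N_{k+3} - N_{k+2}. In (b) and
    (c) the recurrence reduces the step to a linear identity in N_{2n}, N_{2n+1}, N_{2n+2}. *)

Theorem corollary2p20 (n : nat) :
  [/\ \sum_(0 <= k < n.+1) (narayana k)%:R = (narayana (n + 3))%:R - 1 :> rat,
      \sum_(0 <= k < n.+1) (narayana (2 * k))%:R =
        1 / 3 * ((narayana (2 * n + 2))%:R + (narayana (2 * n + 1))%:R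
                 + 2 * (narayana (2 * n))%:R - 2) :> rat
    & \sum_(0 <= k < n.+1) (narayana (2 * k + 1))%:R =
        1 / 3 * (2 * (narayana (2 * n + 2))%:R + 2 * (narayana (2 * n + 1))%:R
                 + (narayana (2 * n))%:R - 1) :> rat].
Proof.
split.
- elim: n => [|n IHn]; first by rewrite big_nat1 subrr.
  by rewrite big_nat_recr //= IHn !addn3 narayanaSSS natrD; ring.
- elim: n => [|n IHn]; first by rewrite big_nat1 /=; field.
  rewrite big_nat_recr // IHn !mulnS.
  (* Three times either side is 4 N_{2n+2} + N_{2n+1} + 2 N_{2n} - 2. The [[LHS]] conversion turns
     the monoid law left by [big_nat_recr] into a plain sum for [field]. *)
  by rewrite !add2n !addn2 !addn1 !narayanaSSS !natrD -[LHS]/(_ + _); field.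
- elim: n => [|n IHn]; first by rewrite big_nat1 /=; field.
  rewrite big_nat_recr // IHn !mulnS.
  (* The new summand is N_{2n+3} = N_{2n+2} + N_{2n}. *)
  by rewrite !add2n !addn2 !addn1 !narayanaSSS !natrD -[LHS]/(_ + _); field.
Qed.
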